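(* Let $X=\sum_{\alpha\in\mathcal X}I_\alpha$, $\mu=\mathbb E X$ and $\Lambda$ be as defined in the context. Suppose that $\mathbf p=(p,\dots,p)\in[0,1]^N$ and $\min_{\alpha\in\mathcal X}|Q(\alpha)|\ge2$. For all $\varepsilon\in(0,1]$ satisfying $(\varepsilon\mu)^2\ge\mathbf 1_{\{\varepsilon<1\}}\Lambda$ we have, with $c=\tfrac12+\tfrac12\mathbf 1_{\{\varepsilon=1\}}$, $$\mathbb P(X\le(1-\varepsilon)\mathbb E X)\ \ge\ c\;\mathbb P\bigl(|\Gamma_{\mathbf p}|\le(1-\varepsilon)\mathbb E|\Gamma_{\mathbf p}|\bigr).$$
   Context: Setting: $\Gamma$ is a finite set with $|\Gamma|=N$, $\mathbf p=(p_i)_{i\in\Gamma}\in[0,1]^N$, and $\Gamma_{\mathbf p}\subseteq\Gamma$ is the random subset in which each $i\in\Gamma$ is included independently with probability $p_i$. $(Q(\alpha))_{\alpha\in\mathcal X}$ is a family of subsets of $\Gamma$ indexed by a finite nonempty set $\mathcal X$, $I_\alpha=\mathbf 1_{\{Q(\alpha)\subseteq\Gamma_{\mathbf p}\}}$, and $X=\sum_{\alpha\in\mathcal X}I_\alpha$. Write $\alpha\sim\beta$ if $\alpha\ne\beta$ and $Q(\alpha)\cap Q(\beta)\neq\emptyset$. Put $\mu=\mathbb E X$ and $\Lambda=\mu+\sum_{(\alpha,\beta)\in\mathcal X\times\mathcal X:\,\alpha\sim\beta}\mathbb E I_\alpha I_\beta$. $\mathbf 1_{\{A\}}$ equals $1$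 if $A$ holds and $0$ otherwise. *)

(* Defs.v *)
From HB Require Import structures.
From mathcomp Require Import all_boot all_order all_algebra.
From mathcomp Require Import reals.
Set Implicit Arguments.
Unset Strict Implicit.
Unset Printing Implicit Defensive.
Import Order.TTheory GRing.Theory Num.Theory.
Local Open Scope ring_scope.

Section RandomSubset.
Context {R : realType} {Gamma : finType}.

(* The probability space of the binomial random subset is realised canonically:
   the sample space is {set Gamma}, the outcome S is the value of the random
   subset itself, and the law is the product of the Bernoulli(p i) laws. *)
Definition rset_law (p : Gamma -> R) (S : {set Gamma}) : R :=
  \prod_(i in S) p i * \prod_(i in ~: S) (1 - p i).

Definition Prob (p : Gamma -> R) (A : pred {set Gamma}) : R :=
  \sum_(S : {set Gamma} | A S) rset_law p S.

Definition Expect (p : Gamma -> R) (f : {set Gamma} -> R) : R :=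
  \sum_(S : {set Gamma}) rset_law p S * f S.

(* Sanity check: elements are included independently, i in S having
   probability p i; A = B = set0 gives total mass 1. *)
Lemma Prob_independent (p : Gamma -> R) (A B : {set Gamma}) :
  [disjoint A & B] ->
  Prob p (fun S => (A \subset S) && (B \subset ~: S)) =
  \prod_(i in A) p i * \prod_(i in B) (1 - p i).
Proof.
move=> dAB.
pose F i := if i \in B then 0 else p i.
pose G i := if i \in A then 0 else 1 - p i.
transitivity (\prod_i (F i + G i)); last first.
  rewrite (bigID (mem A)) /= [X in _ * X](bigID (mem B)) /=.
  rewrite [X in _ * (_ * X)]big1 ?mulr1; last first.
    by move=> i /andP[nA nB]; rewrite /F /G (negbTE nA) (negbTE nB) addrC subrK.
  congr (_ * _).
    by apply: eq_bigr => i iA; rewrite /F /G iA (disjointFr dAB iA) addr0.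
  rewrite (eq_bigl (mem B)).
    by apply: eq_bigr => i /= iB; rewrite /F /G iB (disjointFl dAB iB) add0r.
  by move=> i /=; case iB: (i \in B); rewrite ?andbF // (disjointFl dAB iB).
rewrite bigA_distr /Prob big_mkcond /=; apply: eq_bigr => S _.
rewrite [RHS](bigID (mem S)) /=.
rewrite (eq_bigr F) /=; last by move=> i ->.
rewrite [X in _ = _ * X](eq_bigr G) /=; last by move=> i /negbTE ->.
case: ifP => [/andP[sA sB]|/negbT].
  rewrite /rset_law; congr (_ * _).
    apply: eq_bigr => i iS; rewrite /F; case: ifP => // iB.
    by move: (subsetP sB _ iB); rewrite inE iS.
  apply: eq_big => [i|i]; first by rewrite inE.
  rewrite inE => iS; rewrite /G; case: ifP => // iA.
  by rewrite (subsetP sA _ iA) in iS.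
rewrite negb_and => /orP[] /subsetPn[i iX iS].
  by rewrite [X in _ * X](bigD1 i) //= /G iX mul0r mulr0.
rewrite inE negbK in iS.
by rewrite (bigD1 i) //= /F iX !mul0r.
Qed.

Context {X : finType} (Q : X -> {set Gamma}).

Definition Ind (a : X) (S : {set Gamma}) : R := (Q a \subset S)%:R.

Definition Xsum (S : {set Gamma}) : R := \sum_(a : X) Ind a S.

Definition sim (a b : X) : bool := (a != b) && (Q a :&: Q b != set0).

Definition mu (p : Gamma -> R) : R := Expect p Xsum.

Definition Lambda (p : Gamma -> R) : R :=
  mu p + \sum_(ab : X * X | sim ab.1 ab.2)
           Expect p (fun S => Ind ab.1 S * Ind ab.2 S).

End RandomSubset.

(* Main.v *)
(** Conditioned on its cardinality [j], the binomial random subset is a uniform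
    [j]-subset of a set of size [N], and contains a fixed [k]-set with
    probability [j ^_ k / N ^_ k <= (j / N) ^ k].  When [j <= (1 - eps) p N] and
    all [Q a] have at least two elements, the conditional mean of the count is
    at most [(1 - eps)^2 mu], which is below [(1 - eps) mu] by at least
    [t = eps (1 - eps) mu].  Disjoint sets are negatively correlated under the
    uniform law, so only the diagonal and the pairs [a ~ b] contribute to the
    conditional variance, which is therefore at most
    [(1 - eps)^2 Lambda <= t^2].  The one-sided Chebyshev inequality then gives
    conditional probability at least [1/2], for every such [j]. *)

Require Import Defs.
From HB Require Import structures.
From mathcomp Require Import all_boot all_order all_algebra.
From mathcomp Require Import reals.
From mathcomp Require Import zify ring lra.
Set Implicit Arguments.
Unset Strict Implicit.
Unset Printing Implicit Defensive.
Import Order.TTheory GRing.Theory Num.Theory.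
Local Open Scope ring_scope.

(** * Counting supersets, and inequalities for falling factorials *)

Lemma card_supersets (T : finType) (A : {set T}) (j : nat) :
  (#|[set S : {set T} | A \subset S & #|S| == j]| * #|T| ^_ #|A| =
   'C(#|T|, j) * j ^_ #|A|)%N.
Proof.
have cA : (#|A| <= #|T|)%N by exact: max_card.
have [jA|Aj] := ltnP j #|A|.
  rewrite (ffact_small jA) muln0; apply/eqP; rewrite muln_eq0; apply/orP; left.
  rewrite cards_eq0; apply/eqP/setP => S; rewrite !inE.
  by apply/negP => /andP[/subset_leq_card + /eqP Sj]; rewrite Sj leqNgt jA.
have -> : #|[set S : {set T} | A \subset S & #|S| == j]| =
          'C(#|T| - #|A|, j - #|A|).
  rewrite (_ : #|T| - #|A| = #|~: A|)%N; last by rewrite [RHS]cardsCs setCK.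
  rewrite -cards_draws.
  (* The map [B |-> A :|: B] is injective on subsets of the complement of [A], with inverse
     [S |-> S :\: A]. *)
  rewrite -[RHS](@card_in_imset _ _ (fun B : {set T} => A :|: B)); last first.
    move=> B C; rewrite !inE => /andP[sB _] /andP[sC _] /(congr1 (fun D => D :\: A)).
    rewrite !setDUl setDv !set0U.
    by rewrite !setDE (setIidPl sB) (setIidPl sC).
  apply: eq_card => S; rewrite !inE; apply/andP/imsetP => [[sA /eqP cS]|[B]].
    exists (S :\: A); last by rewrite setDE setUIr setUCr setIT (setUidPr sA).
    by rewrite inE subsetDr cardsD (setIidPr sA) cS eqxx.
  rewrite inE => /andP[sB /eqP cB] ->; split; first exact: subsetUl.
  have /eqP AB0 : A :&: B == set0.
    by rewrite setI_eq0 disjoint_sym disjoints_subset.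
  by rewrite cardsU AB0 cards0 subn0 cB subnKC.
have [jT|Tj] := leqP j #|T|; last by rewrite !bin_small //; lia.
have E1 := bin_fact jT; have E2 := ffact_fact Aj; have E3 := ffact_fact cA.
have E4 := @bin_fact (#|T| - #|A|) (j - #|A|) ltac:(lia).
rewrite (_ : #|T| - #|A| - (j - #|A|) = #|T| - j)%N in E4; last lia.
have g1 := fact_gt0 (j - #|A|); have g2 := fact_gt0 (#|T| - j).
(* After multiplication by these factorials both sides equal the factorial of [#|T|]. *)
apply/eqP; rewrite -(eqn_pmul2r (_ : 0 < (j - #|A|)`! * (#|T| - j)`!)%N); last first.
  by rewrite muln_gt0 g1.
by apply/eqP; nia.
Qed.

Lemma leq_subn_mul (a b k : nat) :
  (a <= b)%N -> ((a - k) * b <= (b - k) * a)%N.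
Proof. nia. Qed.

(** Factor by factor, [(j - i) * n <= (n - i) * j]: this is [(j - i) / (n - i) <= j / n] with
    denominators cleared. *)
Lemma leq_ffact_exp (j n k : nat) :
  (j <= n)%N -> (j ^_ k * n ^ k <= n ^_ k * j ^ k)%N.
Proof.
move=> jn; elim: k => [|k IH]; first by rewrite !ffactn0 !expn0.
rewrite !ffactnSr !expnSr.
by rewrite mulnACA [leqRHS]mulnACA leq_mul // leq_subn_mul.
Qed.

(** Negative correlation of disjoint sets of sizes [k] and [l], with denominators cleared. Each step
    of the induction on [l] compares [(j - k - l) / (n - k - l)] with [(j - l) / (n - l)]. *)
Lemma leq_ffactD (j n k l : nat) :
  (j <= n)%N ->
  (j ^_ (k + l) * (n ^_ k * n ^_ l) <= n ^_ (k + l) * (j ^_ k * j ^_ l))%N.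
Proof.
move=> jn; elim: l => [|l IH]; first by rewrite addn0 !ffactn0; lia.
rewrite addnS !ffactnSr.
have H : ((j - (k + l)) * (n - l) <= (n - (k + l)) * (j - l))%N.
  rewrite ![(k + l)%N]addnC !subnDA; apply: leq_subn_mul; lia.
have := leq_mul IH H.
set a := (j ^_ _)%N; set b := (n ^_ (k + l))%N; nia.
Qed.

(** * Containment probabilities for a uniform subset, and Cantelli's inequality *)

Section FallingRatio.
Variable R : realFieldType.

(** For [j, k <= n], the probability that a uniform [j]-subset of an [n]-set contains a given
    [k]-set. *)
Definition ffact_ratio (n j k : nat) : R := (j ^_ k)%:R / (n ^_ k)%:R.

Lemma ffact_ratio_ge0 (n j k : nat) : 0 <= ffact_ratio n j k.
Proof. by rewrite divr_ge0. Qed.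

Lemma ffact_ratio_le_exp (n j k : nat) :
  (j <= n)%N -> (k <= n)%N -> ffact_ratio n j k <= (j%:R / n%:R) ^+ k.
Proof.
case: n => [|n] jn kn.
  by move: jn kn; rewrite !leqn0 => /eqP -> /eqP ->;
     rewrite /ffact_ratio ffactn0 divr1 expr0.
rewrite /ffact_ratio expr_div_n ler_pdivrMr ?ltr0n ?ffact_gt0 //.
rewrite mulrAC ler_pdivlMr ?exprn_gt0 ?ltr0n //.
by rewrite -!natrX -!natrM ler_nat [leqRHS]mulnC leq_ffact_exp.
Qed.

Lemma ffact_ratioD (n j k l : nat) :
  (j <= n)%N -> (k + l <= n)%N ->
  ffact_ratio n j (k + l) <= ffact_ratio n j k * ffact_ratio n j l.
Proof.
move=> jn kln; rewrite /ffact_ratio mulrACA -invfM.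
have pk : (0 < n ^_ k)%N by rewrite ffact_gt0; lia.
have pl : (0 < n ^_ l)%N by rewrite ffact_gt0; lia.
rewrite ler_pdivrMr ?ltr0n ?ffact_gt0 // [leRHS]mulrAC -!natrM.
rewrite ler_pdivlMr ?ltr0n ?muln_gt0 ?pk //.
by rewrite -!natrM ler_nat [leqRHS]mulnC leq_ffactD.
Qed.

(** Here the size bound on the sets enters: since [d <= 1] and [k >= 2], [d ^+ k <= d ^+ 2], which
    gains a factor [d] over the target [d * mu]. *)
Lemma ffact_ratio_le_scaled (n j k : nat) (d p : R) :
  (j <= n)%N -> (2 <= k <= n)%N -> 0 <= d <= 1 -> 0 <= p ->
  j%:R <= d * (n%:R * p) -> ffact_ratio n j k <= d ^+ 2 * p ^+ k.
Proof.
move=> jn /andP[k2 kn] /andP[d0 d1] p0 jle.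
apply: le_trans (ffact_ratio_le_exp jn kn) _.
have n0 : (0 : R) < n%:R by rewrite ltr0n; lia.
apply: (@le_trans _ _ ((d * p) ^+ k)).
  rewrite lerXn2r ?nnegrE ?divr_ge0 ?mulr_ge0 //.
  by rewrite ler_pdivrMr // -mulrA (mulrC p).
rewrite exprMn ler_wpM2r ?exprn_ge0 //.
by rewrite ler_wiXn2l.
Qed.

Lemma sum_subset_ind (T : finType) (A : {set T}) (j : nat) :
  \sum_(S : {set T} | #|S| == j) (A \subset S)%:R =
  'C(#|T|, j)%:R * ffact_ratio #|T| j #|A| :> R.
Proof.
have f0 : (#|T| ^_ #|A|)%:R != 0 :> R.
  by rewrite pnatr_eq0 -lt0n ffact_gt0 max_card.
rewrite /ffact_ratio mulrA; apply/(canRL (mulfK f0)).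
rewrite -natrM -card_supersets natrM; congr (_ * _).
rewrite -natr_sum -sum1dep_card big_mkcondl /=.
by congr (_%:R).
Qed.

(* One-sided Chebyshev (Cantelli) inequality: it follows from
   [4 t^2 1{s < f} <= (f - m + t)^2]. *)
Lemma upper_half_bound (T : finType) (P : pred T) (f : T -> R) (m t s : R) :
  0 <= t -> m + t <= s ->
  \sum_(x | P x) f x = #|P|%:R * m ->
  \sum_(x | P x) f x ^+ 2 <= #|P|%:R * (m ^+ 2 + t ^+ 2) ->
  #|P|%:R <= 2 * \sum_(x | P x) (f x <= s)%R%:R :> R.
Proof.
move=> t0 mts E1 E2.
have cP : \sum_(x | P x) 1 = #|P|%:R :> R by rewrite sumr_const.
(* A second moment about [m - c]: [c = 0] is the variance, [c = t] the Cantelli shift. *)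
have E (c : R) : \sum_(x | P x) (f x - m + c) ^+ 2 <= #|P|%:R * (t ^+ 2 + c ^+ 2).
  have -> : \sum_(x | P x) (f x - m + c) ^+ 2 =
      \sum_(x | P x) f x ^+ 2 + 2 * (c - m) * \sum_(x | P x) f x
      + (c - m) ^+ 2 * \sum_(x | P x) 1.
    rewrite !mulr_sumr -!big_split /=; apply: eq_bigr => x _; ring.
  rewrite E1 cP; lra.
(* If [t = 0], the variance vanishes and [f] is constantly [m] on [P]; otherwise one may divide by
   [t ^+ 2]. *)
move: t0; rewrite le0r => /predU1P[t0|t0].
  have := E 0; rewrite t0 expr0n /= addr0 mulr0 => E0.
  have {}E0 : \sum_(x | P x) (f x - m + 0) ^+ 2 = 0.
    by apply/eqP; rewrite eq_le E0 sumr_ge0 // => x _; exact: sqr_ge0.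
  have -> : \sum_(x | P x) (f x <= s)%R%:R = #|P|%:R :> R.
    rewrite -cP; apply: eq_bigr => x Px.
    have /eqP := @psumr_eq0P _ _ P _ (fun i _ => sqr_ge0 (f i - m + 0)) E0 x Px.
    rewrite sqrf_eq0 addr0 subr_eq0 => /eqP ->.
    by rewrite (le_trans _ mts) // t0 addr0.
  have := ler0n R #|P|; lra.
have Et := E t.
have : 4 * t ^+ 2 * \sum_(x | P x) (1 - (f x <= s)%R%:R) <= #|P|%:R * (t ^+ 2 + t ^+ 2).
  apply: le_trans Et; rewrite mulr_sumr; apply: ler_sum => x _.
  have [_|sf] := leP (f x) s; first by rewrite subrr mulr0 sqr_ge0.
  by rewrite subr0 mulr1; nra.
rewrite sumrB cP.
set g := \sum_(x | P x) _ => H.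
have t2 : 0 < t ^+ 2 by rewrite exprn_gt0.
rewrite -(ler_pM2l t2); lra.
Qed.

End FallingRatio.

(** * Moments under the binomial law with equal probabilities *)

Section UniformLaw.
Variables (R : realType) (Gamma : finType).
Implicit Types (p : R) (S A : {set Gamma}).

Lemma rset_law_uniform p S :
  rset_law (fun=> p) S = p ^+ #|S| * (1 - p) ^+ (#|Gamma| - #|S|).
Proof. by rewrite /rset_law !prodr_const [#|~: _|]cardsCs setCK. Qed.

Lemma rset_law_uniform_ge0 p S : 0 <= p <= 1 -> 0 <= rset_law (fun=> p) S.
Proof.
by move=> /andP[p0 p1]; rewrite rset_law_uniform mulr_ge0 ?exprn_ge0 ?subr_ge0.
Qed.

Lemma Expect_subset_ind p A :
  Expect (fun=> p) (fun S => (A \subset S)%:R) = p ^+ #|A|.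
Proof.
have d0 : [disjoint A & set0] by rewrite -setI_eq0 setI0.
have := @Prob_independent R Gamma (fun=> p) A set0 d0.
rewrite prodr_const big_set0 mulr1 => <-.
rewrite /Expect /Prob [RHS]big_mkcond; apply: eq_bigr => S _.
by rewrite sub0set andbT; case: (A \subset S); rewrite ?mulr1 ?mulr0.
Qed.

Lemma Expect_card p :
  Expect (fun=> p) (fun S => #|S|%:R) = #|Gamma|%:R * p.
Proof.
transitivity (\sum_(i : Gamma) Expect (fun=> p) (fun S => ([set i] \subset S)%:R)).
  rewrite /Expect exchange_big; apply: eq_bigr => S _ /=.
  rewrite -mulr_sumr -sum1_card natr_sum big_mkcond; congr (_ * _).
  by apply: eq_bigr => i _; rewrite sub1set; case: (i \in S).
under eq_bigr do rewrite Expect_subset_ind cards1 expr1.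
by rewrite sumr_const mulr_natl.
Qed.

Variables (X : finType) (Q : X -> {set Gamma}).

Lemma mu_uniform p : mu Q (fun=> p) = \sum_a p ^+ #|Q a|.
Proof.
under eq_bigr do rewrite -Expect_subset_ind.
rewrite /mu /Expect exchange_big; apply: eq_bigr => S _ /=.
by rewrite -mulr_sumr.
Qed.

Lemma Ind_mul a b S :
  Ind Q a S * Ind Q b S = (Q a :|: Q b \subset S)%:R :> R.
Proof. by rewrite /Ind -natrM mulnb subUset. Qed.

(** The diagonal [a == b] supplies [mu], because [Q a :|: Q a = Q a]. The single double sum can then
    be compared term by term with a second moment. *)
Lemma Lambda_uniform p :
  Lambda Q (fun=> p) =
  \sum_a \sum_b ((a == b) || sim Q a b)%:R * p ^+ #|Q a :|: Q b|.
Proof.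
have E (a b : X) :
    Expect (fun=> p) (fun S => Ind Q a S * Ind Q b S) = p ^+ #|Q a :|: Q b|.
  rewrite -Expect_subset_ind; apply: eq_bigr => S _.
  by rewrite Ind_mul.
have -> : Lambda Q (fun=> p) = \sum_a p ^+ #|Q a| +
    \sum_a \sum_b if sim Q a b then p ^+ #|Q a :|: Q b| else 0.
  rewrite /Lambda mu_uniform pair_bigA [X in _ + X]big_mkcond; congr (_ + _).
  by apply: eq_bigr => ab _; rewrite E.
rewrite -big_split /=.
apply: eq_bigr => a _.
rewrite [RHS](bigD1 a) //= eqxx mul1r setUid [in LHS](bigD1 a) //=.
rewrite {1}/sim eqxx add0r; congr (_ + _); apply: eq_bigr => b ba.
by rewrite eq_sym (negbTE ba) /=; case: ifP; rewrite ?mul1r ?mul0r.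
Qed.

(** * The count on a layer of sets of fixed cardinality *)

Lemma sum_Xsum_layer (j : nat) :
  \sum_(S : {set Gamma} | #|S| == j) Xsum Q S =
  'C(#|Gamma|, j)%:R * \sum_a ffact_ratio R #|Gamma| j #|Q a|.
Proof.
rewrite /Xsum exchange_big mulr_sumr; apply: eq_bigr => a _ /=.
exact: sum_subset_ind.
Qed.

Lemma sum_Xsum_sqr_layer (j : nat) :
  \sum_(S : {set Gamma} | #|S| == j) Xsum Q S ^+ 2 =
  'C(#|Gamma|, j)%:R *
    \sum_a \sum_b ffact_ratio R #|Gamma| j #|Q a :|: Q b|.
Proof.
transitivity (\sum_(S : {set Gamma} | #|S| == j)
    \sum_a \sum_b (Q a :|: Q b \subset S)%:R : R).
  apply: eq_bigr => S _; rewrite expr2 /Xsum mulr_suml; apply: eq_bigr => a _.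
  by rewrite mulr_sumr; apply: eq_bigr => b _; rewrite Ind_mul.
rewrite exchange_big mulr_sumr; apply: eq_bigr => a _ /=.
rewrite exchange_big mulr_sumr; apply: eq_bigr => b _ /=.
exact: sum_subset_ind.
Qed.

(** Each pair is charged to one summand: pairs that are equal or related by [sim] to [Lambda], their
    union having at least two elements; the others are disjoint, and negative correlation charges
    them to the squared mean. *)
Lemma second_moment_layer (j : nat) (d p : R) :
  (j <= #|Gamma|)%N -> (forall a, (2 <= #|Q a|)%N) -> 0 <= d <= 1 -> 0 <= p ->
  j%:R <= d * (#|Gamma|%:R * p) ->
  \sum_a \sum_b ffact_ratio R #|Gamma| j #|Q a :|: Q b| <=
  (\sum_a ffact_ratio R #|Gamma| j #|Q a|) ^+ 2 + d ^+ 2 * Lambda Q (fun=> p).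
Proof.
move=> jn Q2 d01 p0 jle.
rewrite Lambda_uniform expr2 mulr_suml mulr_sumr -big_split /=.
apply: ler_sum => a _; rewrite !mulr_sumr -big_split /=.
apply: ler_sum => b _.
have r0 (c : X) := ffact_ratio_ge0 R #|Gamma| j #|Q c|.
have [_|nab] := boolP ((a == b) || sim Q a b).
  rewrite mul1r; apply: (@le_trans _ _ (d ^+ 2 * p ^+ #|Q a :|: Q b|)).
    apply: ffact_ratio_le_scaled => //; rewrite max_card andbT.
    by rewrite (leq_trans (Q2 a)) // subset_leq_card // subsetUl.
  by rewrite lerDr mulr_ge0.
rewrite mul0r mulr0 addr0.
have /eqP dab : Q a :&: Q b == set0.
  by move: nab; rewrite negb_or /sim => /andP[-> /=]; rewrite negbK.
have cU : #|Q a :|: Q b| = (#|Q a| + #|Q b|)%N.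
  by rewrite cardsU dab cards0 subn0.
by rewrite cU ffact_ratioD // -cU max_card.
Qed.

Lemma layer_lower_tail (j : nat) (p eps : R) :
  (j <= #|Gamma|)%N -> (forall a, (2 <= #|Q a|)%N) -> 0 <= p -> 0 <= eps <= 1 ->
  Lambda Q (fun=> p) <= (eps * mu Q (fun=> p)) ^+ 2 ->
  j%:R <= (1 - eps) * (#|Gamma|%:R * p) ->
  \sum_(S : {set Gamma} | #|S| == j) 1 <=
  2 * \sum_(S : {set Gamma} | #|S| == j)
        (Xsum Q S <= (1 - eps) * mu Q (fun=> p))%R%:R :> R.
Proof.
move=> jn Q2 p0 /andP[e0 e1] LM jle.
have d01 : 0 <= 1 - eps <= 1 by lra.
set M := mu Q _ in LM *.
have M0 : 0 <= M by rewrite /M mu_uniform sumr_ge0 // => a _; rewrite exprn_ge0.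
have cL : #|[pred S : {set Gamma} | #|S| == j]| = 'C(#|Gamma|, j).
  by rewrite -card_draws; apply: eq_card => S; rewrite !inE.
rewrite sumr_const.
(* The choice of [t] rests on [(1 - eps) ^+ 2 + eps * (1 - eps) = 1 - eps]. *)
apply: (@upper_half_bound _ _ _ _ (\sum_a ffact_ratio R #|Gamma| j #|Q a|)
          (eps * (1 - eps) * M)).
- by rewrite !mulr_ge0 ?subr_ge0.
- have : \sum_a ffact_ratio R #|Gamma| j #|Q a| <= (1 - eps) ^+ 2 * M.
    rewrite /M mu_uniform mulr_sumr; apply: ler_sum => a _.
    by apply: ffact_ratio_le_scaled => //; rewrite Q2 max_card.
  lra.
- by rewrite cL -sum_Xsum_layer.
- rewrite cL sum_Xsum_sqr_layer ler_wpM2l //.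
  apply: le_trans (second_moment_layer jn Q2 d01 p0 jle) _.
  rewrite lerD2l.
  rewrite (_ : (eps * (1 - eps) * M) ^+ 2 = (1 - eps) ^+ 2 * (eps * M) ^+ 2).
    by rewrite ler_wpM2l // sqr_ge0.
  by ring.
Qed.

(** All sets of one cardinality have the same weight, so counting bounds on the layers add up to a
    bound on probabilities. *)
Lemma Prob_le_layerwise p (u : R) (A : pred {set Gamma}) :
  0 <= p <= 1 ->
  (forall j : nat, (j <= #|Gamma|)%N -> j%:R <= u ->
     \sum_(S : {set Gamma} | #|S| == j) 1 <=
     2 * \sum_(S : {set Gamma} | #|S| == j) (A S)%:R :> R) ->
  Prob (fun=> p) (fun S => #|S|%:R <= u) <= 2 * Prob (fun=> p) A.
Proof.
move=> p01 H.
(* First [A] is restricted to the layers with [j <= u]; the discarded part of [A] has nonnegative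
   mass. *)
apply: (@le_trans _ _
  (2 * \sum_(S : {set Gamma} | #|S|%:R <= u) rset_law (fun=> p) S * (A S)%:R)).
  pose h (S : {set Gamma}) : 'I_(#|Gamma|.+1) := inord #|S|.
  have hE S : h S = #|S| :> nat by rewrite inordK // ltnS max_card.
  rewrite mulr_sumr /Prob.
  rewrite (partition_big h predT) //= [leRHS](partition_big h predT) //=.
  apply: ler_sum => j _.
  have hP S : (#|S|%:R <= u) && (h S == j) = (#|S| == j) && (j%:R <= u).
    by rewrite -val_eqE /= hE andbC; case: eqP => // ->.
  rewrite (eq_bigl _ _ hP) [leRHS](eq_bigl _ _ hP).
  have [ju|_] := boolP (j%:R <= u); last first.
    by rewrite !big_pred0 // => S; rewrite andbF.
  pose w := p ^+ j * (1 - p) ^+ (#|Gamma| - j).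
  have -> : \sum_(S : {set Gamma} | (#|S| == j) && true) rset_law (fun=> p) S =
            w * \sum_(S : {set Gamma} | #|S| == j) 1.
    rewrite mulr_sumr; apply: eq_big => [S|S /andP[/eqP Sj _]].
      by rewrite andbT.
    by rewrite mulr1 rset_law_uniform Sj.
  have -> : \sum_(S : {set Gamma} | (#|S| == j) && true)
               2 * (rset_law (fun=> p) S * (A S)%:R) =
            w * (2 * \sum_(S : {set Gamma} | #|S| == j) (A S)%:R).
    rewrite !mulr_sumr; apply: eq_big => [S|S /andP[/eqP Sj _]].
      by rewrite andbT.
    by rewrite rset_law_uniform Sj mulrCA.
  have /andP[p0 p1] := p01.
  rewrite ler_wpM2l ?mulr_ge0 ?exprn_ge0 ?subr_ge0 //.
  by apply: H => //; rewrite -ltnS.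
rewrite ler_pM2l ?ltr0n // /Prob big_mkcond [leRHS]big_mkcond /=.
apply: ler_sum => S _; have w0 := rset_law_uniform_ge0 S p01.
by case: (A S); case: ifP => _; rewrite ?mulr1 ?mulr0.
Qed.

End UniformLaw.

Theorem theorem15 (R : realType) (Gamma X : finType) (Q : X -> {set Gamma})
    (p : R) (eps : R) :
  (0 < #|X|)%N ->
  0 <= p <= 1 ->
  (forall a : X, (2 <= #|Q a|)%N) ->
  0 < eps <= 1 ->
  (eps < 1)%R%:R * Lambda Q (fun=> p) <= (eps * mu Q (fun=> p)) ^+ 2 ->
  (2^-1 + 2^-1 * (eps == 1)%:R) *
    Prob (fun=> p) (fun S : {set Gamma} =>
      #|S|%:R <= (1 - eps) * Expect (fun=> p) (fun S' : {set Gamma} => #|S'|%:R))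
  <= Prob (fun=> p) (fun S : {set Gamma} =>
      Xsum Q S <= (1 - eps) * Expect (fun=> p) (Xsum Q)).
Proof.
move=> _ p01 Q2 /andP[e0 e1] LM; have /andP[p0 p1] := p01.
have [eps1|neps1] := eqVneq eps 1.
  (* For [eps = 1] the event on the left is that [S] is empty, and then no nonempty [Q a] lies in
     [S], so the count is 0. *)
  rewrite eps1 subrr !mul0r (_ : 2^-1 + 2^-1 * 1 = 1) ?mul1r; last by field.
  rewrite /Prob big_mkcond [leRHS]big_mkcond /=.
  apply: ler_sum => S _; have w0 := rset_law_uniform_ge0 S p01.
  case: ifP => [|_]; last by case: ifP.
  rewrite lern0 cards_eq0 => /eqP ->; rewrite /Xsum big1 ?lexx // => a _.
  rewrite /Ind subset0 -cards_eq0.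
  by have := Q2 a; case: #|Q a|.
have lt1 : eps < 1 by rewrite lt_neqAle neps1.
move: LM; rewrite lt1 mul1r => LM.
(* For [eps < 1] the constant is one half, moved to the right as a factor 2. *)
rewrite mulr0 addr0 ler_pdivrMl ?ltr0n // Expect_card.
apply: Prob_le_layerwise => // j jn ju.
by apply: layer_lower_tail => //; rewrite ltW.
Qed.
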